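(* Let $A\in\mathbb{C}^{n,n}$, $B\in\mathbb{C}^{n,m}$ be such that there exists $K\in\mathbb{C}^{m,n}$ with $zI_n-A-BK$ invertible for all $z\in\mathbb{C}$, $|z|\ge1$. Let $Q=Q'\in\mathbb{C}^{n+m,n+m}$, $\sigma(x,u)=[x;u]'Q[x;u]$, and suppose that the matrix $\Pi(z)=[(zI_n-A)^{-1}B;\,I_m]'Q[(zI_n-A)^{-1}B;\,I_m]$ is positive definite for all $z$ with $|z|=1$ except possibly finitely many. Let $P=P'\in\mathbb{C}^{n,n}$, $C\in\mathbb{C}^{m,n}$, $D\in\mathbb{C}^{m,m}$ satisfy $$\sigma(x,u)+x'Px-(Ax+Bu)'P(Ax+Bu)=|Cx+Du|^2\quad\forall\,x\in\mathbb{C}^n,u\in\mathbb{C}^m,\qquad \det\begin{bmatrix}\lambda A-I_n&\lambda B\\ C&D\end{bmatrix}\ne0\ \ \forall\,|\lambda|<1.$$ Fix $a\in\mathbb{C}^n$ and call a pair of sequences $x:\mathbb{Z}_+\to\mathbb{C}^n$, $u:\mathbb{Z}_+\to\mathbb{C}^m$ feasible if $x(t+1)=Ax(t)+Bu(t)$ for all $t\in\mathbb{Z}_+$, $x(0)=a$, and $\sum_{t=0}^\infty(|x(t)|^2+|u(t)|^2)<\infty$; for such a pair let $\Phi(x,u)=\sum_{t=0}^\infty\sigma(x(t),u(t))$. Then the infimum of $\Phi$ over all feasible pairs equals $-a'Pa$, and for any sequence $(x_i,u_i)$, $i=1,2,\dots$, of feasible pairs, $\sum_{t=0}^\infty|Cx_i(t)+Du_i(t)|^2\to0$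 as $i\to\infty$ if and only if $\Phi(x_i,u_i)\to -a'Pa$.
   Context: $\mathbb{Z}_+=\{0,1,2,\dots\}$. $M'$ denotes the conjugate transpose of $M$; $[x;u]$ denotes the stacked column vector. *)

(* Defs.v *)
From HB Require Import structures.
From mathcomp Require Import all_boot all_order all_algebra.
From mathcomp Require Import all_classical all_reals all_analysis.
From mathcomp Require Import complex.
Import numFieldNormedType.Exports.
Set Implicit Arguments. Unset Strict Implicit. Unset Printing Implicit Defensive.
Import Order.TTheory GRing.Theory Num.Theory.
Local Open Scope ring_scope.
Local Open Scope complex_scope.

Definition ctmx (R : rcfType) (p q : nat) (M : 'M[R[i]]_(p, q)) : 'M[R[i]]_(q, p) :=
  (map_mx (@conjc R) M)^T.

Definition hermmx (R : rcfType) (p : nat) (M : 'M[R[i]]_p) : Prop := ctmx M = M.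

Definition posdef (R : rcfType) (p : nat) (M : 'M[R[i]]_p) : Prop :=
  hermmx M /\ forall v : 'cV[R[i]]_p, v != 0 -> 0 < (ctmx v *m M *m v) 0 0.

Definition norm2 (R : rcfType) (p : nat) (v : 'cV[R[i]]_p) : R :=
  \sum_i ((complex.Re (v i 0)) ^+ 2 + (complex.Im (v i 0)) ^+ 2).

Definition sigmaQ (R : rcfType) (n m : nat) (Q : 'M[R[i]]_(n + m))
  (x : 'cV[R[i]]_n) (u : 'cV[R[i]]_m) : R[i] :=
  (ctmx (col_mx x u) *m Q *m col_mx x u) 0 0.

Definition PiQ (R : rcfType) (n m : nat) (A : 'M[R[i]]_n) (B : 'M[R[i]]_(n, m))
  (Q : 'M[R[i]]_(n + m)) (z : R[i]) : 'M[R[i]]_m :=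
  let M := col_mx (invmx (z%:M - A) *m B) (1%:M : 'M[R[i]]_m) in
  ctmx M *m Q *m M.

Definition feasible (R : realType) (n m : nat) (A : 'M[R[i]]_n) (B : 'M[R[i]]_(n, m))
  (a : 'cV[R[i]]_n) (x : nat -> 'cV[R[i]]_n) (u : nat -> 'cV[R[i]]_m) : Prop :=
  (forall t, x t.+1 = A *m x t + B *m u t) /\ x 0%N = a /\
  (\sum_(t <oo) ((norm2 (x t) + norm2 (u t))%:E) < +oo)%E.

(* Phi(x,u) = sum_t sigma(x(t),u(t)); sigma is real-valued since Q = Q', so we sum
   its real part as a real series (limit of partial sums). *)
Definition Phi (R : realType) (n m : nat) (Q : 'M[R[i]]_(n + m))
  (x : nat -> 'cV[R[i]]_n) (u : nat -> 'cV[R[i]]_m) : R :=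
  limn (@series R (fun t => complex.Re (sigmaQ Q (x t) (u t)))).

Definition outnorm (R : realType) (n m : nat) (C : 'M[R[i]]_(m, n)) (D : 'M[R[i]]_m)
  (x : nat -> 'cV[R[i]]_n) (u : nat -> 'cV[R[i]]_m) : R :=
  limn (@series R (fun t => norm2 (C *m x t + D *m u t))).

(* Main.v *)
Require Import Defs.
From HB Require Import structures.
From mathcomp Require Import all_boot all_order all_algebra.
From mathcomp Require Import all_classical all_reals all_analysis.
From mathcomp Require Import complex.
From mathcomp Require Import ring lra.
Import numFieldNormedType.Exports.
Import Order.TTheory GRing.Theory Num.Theory.
Local Open Scope ring_scope.
Local Open Scope complex_scope.
Local Open Scope classical_set_scope.

Set Implicit Arguments.
Unset Strict Implicit.

(** The storage function telescopes, so [Phi = outnorm - a'Pa] on feasible pairs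
    and everything reduces to [inf outnorm = 0]. Let [J a] be this infimum. It is a
    nonnegative quadratic form (it satisfies the parallelogram law), and by dynamic
    programming [J y <= |Cy + Dv|^2 + J (Ay + Bv)]; in particular [J x <= J (F x)]
    for the zero dynamics [F = A - B D^-1 C], whose eigenvalues lie in the closed
    unit disc by the determinant condition. By Cayley-Hamilton it is enough to show
    that [J (F x - l x) = 0] with [|l| <= 1] forces [J x = 0]. If [|l| < 1], then
    [J x <= J (F x) = |l|^2 J x]. If [|l| = 1], let [y] be any feasible trajectory
    from [x]: comparing [J (y t + k l^t x)] along [t] for large [k] shows that the
    cross term between [l^t x] and [y t] does not decrease. It starts at [2 J x] and
    is at most [J x + J (y t)], hence [J x <= J (y t)], and [J (y t)] is bounded by a
    tail of a convergent series. *)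

(** * Squared moduli and norms *)

Definition sqmod (R : rcfType) (c : R[i]) : R :=
  complex.Re c ^+ 2 + complex.Im c ^+ 2.

Lemma sqmod_ge0 (R : rcfType) (c : R[i]) : 0 <= sqmod c.
Proof. by rewrite addr_ge0 ?sqr_ge0. Qed.

Lemma sqmodM (R : rcfType) (c d : R[i]) : sqmod (c * d) = sqmod c * sqmod d.
Proof. by case: c d => [a b] [e f]; rewrite /sqmod /=; ring. Qed.

Lemma sqmod_real (R : rcfType) (r : R) : sqmod r%:C = r ^+ 2.
Proof. by rewrite /sqmod /= expr0n addr0. Qed.

Lemma sqmodE (R : rcfType) (c : R[i]) : (sqmod c)%:C = `|c| ^+ 2.
Proof.
rewrite normc_def -rmorphXn /= sqr_sqrtr //.
by case: c => a b; rewrite addr_ge0 ?sqr_ge0.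
Qed.

Lemma norm2E (R : rcfType) p (v : 'cV[R[i]]_p) : norm2 v = \sum_i sqmod (v i 0).
Proof. by []. Qed.

Lemma norm2_ge0 (R : rcfType) p (v : 'cV[R[i]]_p) : 0 <= norm2 v.
Proof. by apply: sumr_ge0 => i _; apply: sqmod_ge0. Qed.

Lemma norm20 (R : rcfType) p : norm2 (0 : 'cV[R[i]]_p) = 0.
Proof. by rewrite norm2E big1 // => i _; rewrite mxE sqmod_real expr0n. Qed.

Lemma norm2Z (R : rcfType) p c (v : 'cV[R[i]]_p) :
  norm2 (c *: v) = sqmod c * norm2 v.
Proof.
by rewrite !norm2E mulr_sumr; apply: eq_bigr => i _; rewrite mxE sqmodM.
Qed.

Lemma norm2_par (R : rcfType) p (v w : 'cV[R[i]]_p) :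
  norm2 (v + w) + norm2 (v - w) = 2 * (norm2 v + norm2 w).
Proof.
rewrite !norm2E -!big_split mulr_sumr; apply: eq_bigr => i _ /=; rewrite !mxE.
by case: (v i 0) (w i 0) => [a b] [c d]; rewrite /sqmod /=; ring.
Qed.

Lemma norm2D (R : rcfType) p (v w : 'cV[R[i]]_p) :
  norm2 (v + w) <= 2 * (norm2 v + norm2 w).
Proof. by rewrite -norm2_par lerDl norm2_ge0. Qed.

(** The difference of the two sides is [e^-1] times the squared norm of [e *: v - w]. A small [e]
    keeps the weight of [v] close to 1, so that a contraction factor on [v] survives. *)
Lemma norm2_young (R : rcfType) p (e : R) (v w : 'cV[R[i]]_p) : 0 < e ->
  norm2 (v + w) <= (1 + e) * norm2 v + (1 + e^-1) * norm2 w.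
Proof.
move=> e0; rewrite !norm2E !mulr_sumr -big_split; apply: ler_sum => i _ /=.
rewrite mxE; case: (v i 0) (w i 0) => [a b] [c d]; rewrite /sqmod /=.
have f0 : 0 < e^-1 by rewrite invr_gt0.
have ef : e * e^-1 = 1 by rewrite divff ?gt_eqF.
rewrite -subr_ge0.
have -> : (1 + e) * (a ^+ 2 + b ^+ 2) + (1 + e^-1) * (c ^+ 2 + d ^+ 2) -
  ((a + c) ^+ 2 + (b + d) ^+ 2) =
  e^-1 * ((e * a - c) ^+ 2 + (e * b - d) ^+ 2).
  by field; rewrite gt_eqF.
by apply: mulr_ge0; [exact: ltW | rewrite addr_ge0 ?sqr_ge0].
Qed.

Lemma mulmx_norm2_bounded (R : rcfType) p q (M : 'M[R[i]]_(p, q)) :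
  exists c, 0 <= c /\ forall v, norm2 (M *m v) <= c * norm2 v.
Proof.
(* [M *m v] is the combination of the columns of [M] with coefficients [v j 0]; the constant is
   built by induction on the list of columns. *)
suff /(_ (index_enum 'I_q)) [c [c0 H]] : forall s : seq 'I_q, exists c, 0 <= c /\
    forall v : 'cV_q, norm2 (\sum_(j <- s) v j 0 *: col j M) <= c * norm2 v.
  exists c; split=> // v; apply: le_trans (H v); rewrite le_eqVlt; apply/orP; left.
  apply/eqP; congr norm2; apply/matrixP => i j; rewrite !mxE summxE.
  by apply: eq_bigr => k _; rewrite !mxE (ord1 j) mulrC.
elim=> [|j s [c [c0 IH]]].
  by exists 0; split=> // v; rewrite big_nil norm20 mul0r.
exists (2 * (norm2 (col j M) + c)); split=> [|v].
  by rewrite mulr_ge0 // addr_ge0 // norm2_ge0.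
rewrite big_cons; apply: le_trans (norm2D _ _) _.
rewrite -mulrA ler_pM2l // mulrDl lerD // norm2Z mulrC ler_wpM2l ?norm2_ge0 //.
by rewrite norm2E (bigD1 j) //= lerDl sumr_ge0 // => i _; apply: sqmod_ge0.
Qed.

Lemma form_norm2_bounded (R : rcfType) p (P : 'M[R[i]]_p) :
  exists c, forall x, `|complex.Re ((ctmx x *m P *m x) 0 0)| <= c * norm2 x.
Proof.
have [c [c0 H]] := mulmx_norm2_bounded P.
exists (1 + c) => x; rewrite -mulmxA.
have K (y : 'cV_p) : `|complex.Re ((ctmx x *m y) 0 0)| <= norm2 x + norm2 y.
  rewrite mxE raddf_sum; apply: le_trans (ler_norm_sum _ _ _) _.
  rewrite !norm2E -big_split; apply: ler_sum => i _ /=; rewrite !mxE.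
  case: (x i 0) (y i 0) => [a b] [e d]; rewrite /sqmod /= ler_norml.
  have := (sqr_ge0 (a + e), sqr_ge0 (b + d), sqr_ge0 (a - e), sqr_ge0 (b - d)).
  case=> [[[]]]; have := (sqr_ge0 a, sqr_ge0 b, sqr_ge0 e, sqr_ge0 d).
  by case=> [[[]]] *; apply/andP; split; lra.
by apply: le_trans (K _) _; rewrite mulrDl mul1r lerD2l.
Qed.

(** * Nonnegative quadratic forms *)

(** A nonnegative Hermitian form, described through its values alone: these properties can be
    checked for an infimum, with no matrix of the form at hand. *)
Definition quadratic (R : rcfType) (V : lmodType R[i]) (J : V -> R) : Prop :=
  [/\ forall v, 0 <= J v,
      forall c v, J (c *: v) = sqmod c * J v &
      forall v w, J (v + w) + J (v - w) = 2 * (J v + J w)].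

(** Twice the real part of the sesquilinear form polar to [J]. *)
Definition cross (R : rcfType) (V : lmodType R[i]) (J : V -> R) (z y : V) : R :=
  J (y + z) - J y - J z.

(** The parallelogram law at [y + z *+ k.+1] and [z] is a second-order recursion in [k], hence the
    induction on two consecutive values. Integer multiples suffice later, so no continuity of [J] is
    involved. *)
Lemma quadratic_line (R : rcfType) (V : lmodType R[i]) (J : V -> R) (y z : V) k :
  quadratic J -> J (y + z *+ k) = J y + k%:R * cross J z y + k%:R ^+ 2 * J z.
Proof.
case=> _ _ Jpar.
suff [] : J (y + z *+ k) = J y + k%:R * cross J z y + k%:R ^+ 2 * J z /\
  J (y + z *+ k.+1) = J y + k.+1%:R * cross J z y + k.+1%:R ^+ 2 * J z by [].
elim: k => [|k [IH1 IH2]].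
  by rewrite mulr0n mulr1n addr0 /cross; split; ring.
split=> //.
have := Jpar (y + z *+ k.+1) z.
rewrite -addrA -mulrSr.
have -> : y + z *+ k.+1 - z = y + z *+ k by rewrite mulrSr addrA addrK.
rewrite IH1 IH2 !mulrS => H.
(* Adding and subtracting the value at [k] makes the left side of the parallelogram identity [H]
   appear. *)
have -> : J (y + (z + (z + z *+ k))) = J (y + (z + (z + z *+ k))) +
  (J y + k%:R * cross J z y + k%:R ^+ 2 * J z) -
  (J y + k%:R * cross J z y + k%:R ^+ 2 * J z) by rewrite addrK.
by rewrite H; ring.
Qed.

Lemma affine_le_slope (R : archiRealFieldType) (a b d e : R) :
  (forall k : nat, a + k%:R * d <= b + k%:R * e) -> d <= e.
Proof.
move=> H; rewrite leNgt; apply/negP => ed.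
have de0 : 0 < d - e by rewrite subr_gt0.
have := archi_boundP (normr_ge0 ((b - a) / (d - e))).
set k := Num.bound _ => Hk.
have {Hk} : (b - a) / (d - e) < k%:R by apply: le_lt_trans Hk; apply: ler_norm.
by rewrite ltr_pdivrMr //; have := H k => *; lra.
Qed.

Lemma quadraticN (R : rcfType) (V : lmodType R[i]) (J : V -> R) z :
  quadratic J -> J (- z) = J z.
Proof.
case=> _ JZ _; rewrite -scaleN1r JZ /sqmod /=; ring.
Qed.

(** If [J u = 0], then [J] is affine and nonnegative along [y + z *+ k] with [z = u], so its slope
    is nonnegative. This holds for [w] and [- w], whose slopes add up to 0 by the parallelogram
    law. *)
Lemma quadratic_null (R : realType) (V : lmodType R[i]) (J : V -> R) (y w : V) :
  quadratic J -> J w = 0 -> J (y + w) = J y.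
Proof.
move=> qJ w0; have [J0 _ Jpar] := qJ.
have cross0 (u : V) : J u = 0 -> 0 <= cross J u y.
  move=> u0; apply: (@affine_le_slope R 0 (J y)) => k.
  by rewrite mulr0 addr0; have := J0 (y + u *+ k); rewrite quadratic_line // u0 mulr0 addr0.
have := cross0 w w0; have := cross0 (- w); rewrite quadraticN // => /(_ w0).
have := Jpar y w; rewrite /cross (quadraticN w) // w0 => *; lra.
Qed.

(** [x] is an eigenvector of [F] up to a null vector of [J]. Along [l ^+ t *: x] the terms quadratic
    in [k] are all [J x] and cancel, so large [k] compares the cross terms; [e] plays the part of
    the stage costs. *)
Lemma quadratic_le_unimodular (R : realType) n (J : 'cV[R[i]]_n -> R)
    (F : 'M[R[i]]_n) (x : 'cV[R[i]]_n) (l : R[i]) (y : nat -> 'cV[R[i]]_n)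
    (e : nat -> R) :
  quadratic J -> sqmod l = 1 -> J (F *m x - l *: x) = 0 ->
  (forall t z, J (y t + z) <= e t + J (y t.+1 + F *m z)) ->
  y 0%N = x -> forall t, J x <= J (y t).
Proof.
move=> qJ l1 Fx step y0 t; have [J0 JZ Jpar] := qJ.
pose z t := l ^+ t *: x.
have zt s : J (z s) = J x.
  rewrite JZ; suff -> : sqmod (l ^+ s) = 1 by rewrite mul1r.
  elim: s => [|s IH]; first by rewrite expr0 /sqmod /=; ring.
  by rewrite exprS sqmodM l1 mul1r.
have Fz s k v : J (v + F *m (z s *+ k)) = J (v + z s.+1 *+ k).
  have -> : F *m (z s *+ k) = z s.+1 *+ k + (l ^+ s *+ k) *: (F *m x - l *: x).
    rewrite /z !scalerMnl -scalemxAr scalerBr scalerA exprSr mulrnAl addrC.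
    by rewrite subrK.
  by rewrite addrA quadratic_null // JZ Fx mulr0.
have mono s : cross J (z s) (y s) <= cross J (z s.+1) (y s.+1).
  apply: (@affine_le_slope R (J (y s)) (e s + J (y s.+1))) => k.
  have := step s (z s *+ k); rewrite Fz !quadratic_line // !zt => *; lra.
have : cross J x (y 0%N) <= cross J (z t) (y t).
  elim: t => [|t IH]; first by rewrite /z expr0 scale1r.
  exact: le_trans IH (mono t).
(* [J (y t - z t) >= 0] bounds the cross term by [J x + J (y t)], while at time 0 it is
   [J (x + x) - 2 * J x = 2 * J x]. *)
have := J0 (y t - z t); have := Jpar (y t) (z t).
have := JZ 2%:R x; rewrite scaler_nat mulr2n y0 /cross !zt => ->.
have -> : sqmod (2%:R : R[i]) = 4%:R by rewrite /sqmod /=; ring.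
move=> *; lra.
Qed.

(** By Cayley-Hamilton the product of the factors [F - l] over all roots sends [x] to 0, where [S]
    holds; the hypothesis on eigenvalues then peels off one factor at a time. This stands in for a
    Jordan form. *)
Lemma char_poly_root_ind (K : closedFieldType) n (F : 'M[K]_n) (S : 'cV[K]_n -> Prop) :
  S 0 ->
  (forall l x, eigenvalue F l -> S (F *m x - l *: x) -> S x) ->
  forall x, S x.
Proof.
case: n F S => [|n] F S S0 Sstep x.
  by have -> : x = 0 by apply/matrixP => -[].
have [r Er] := closed_field_poly_normal (char_poly F).
rewrite (monicP (char_poly_monic F)) scale1r in Er.
have : all (fun l => eigenvalue F l) r.
  by apply/allP => l lr; rewrite eigenvalue_root_char Er root_prod_XsubC.
have : S (horner_mx F (\prod_(l <- r) ('X - l%:P)) *m x).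
  by rewrite -Er Cayley_Hamilton mul0mx.
elim: r x {Er} => [|l r IH] x; first by rewrite big_nil rmorph1 mul1mx.
rewrite big_cons rmorphM rmorphB /= horner_mx_X horner_mx_C => H /andP[Fl Fr].
apply: IH Fr; apply: Sstep Fl _.
by move: H; rewrite -mulmxA mulmxBl mul_scalar_mx.
Qed.

(** * Series and square-summable sequences *)

Lemma series_nneg_le_lim (R : realType) (f : nat -> R) :
  (forall t, 0 <= f t) -> cvgn (series f) -> forall T, series f T <= limn (series f).
Proof.
move=> f0 cf T; apply: nondecreasing_cvgn_le => //.
by apply: nondecreasing_series => ? _ _.
Qed.

Lemma bounded_cvg_series (R : realType) (f : nat -> R) M :
  (forall t, 0 <= f t) -> (forall T, series f T <= M) -> cvgn (series f).
Proof.
move=> f0 fM; apply: nondecreasing_is_cvgn.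
  by apply: nondecreasing_series => ? _ _.
by exists M => _ [T _ <-].
Qed.

Lemma series_shiftE (R : realType) (f : nat -> R) T :
  series f T.+1 = f 0%N + series (fun t => f t.+1) T.
Proof. by rewrite !seriesEnat /= big_nat_recl. Qed.

Lemma cvg_series_shift (R : realType) (f : nat -> R) (l : R) :
  (series (fun t => f t.+1) @ \oo --> l) -> series f @ \oo --> f 0%N + l.
Proof.
move=> fl; rewrite -cvg_shiftS; under eq_fun do rewrite series_shiftE.
by apply: cvgD => //; apply: cvg_cst.
Qed.

Lemma cvg_series_tail (R : realType) (f : nat -> R) s :
  cvgn (series f) ->
  series (fun t => f (t + s)%N) @ \oo --> limn (series f) - series f s.
Proof.
move=> cf; elim: s => [|s IH].
  rewrite [series f 0%N]big_geq // subr0.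
  by have -> : (fun t => f (t + 0)%N) = f by apply/funext => t; rewrite addn0.
move: IH; rewrite -cvg_shiftS seriesSr opprD addrA => IH.
have -> : series (fun t => f (t + s.+1)%N) =
   (fun T => series (fun t => f (t + s)%N) T.+1 - f s).
  apply/funext => T; rewrite series_shiftE add0n addrAC subrr add0r.
  by congr (series _ T); apply/funext => t; rewrite addSnnS.
by apply: cvgB => //; apply: cvg_cst.
Qed.

Lemma cvg_norm2D (R : realType) p (v w : nat -> 'cV[R[i]]_p) :
  cvgn (series (fun t => norm2 (v t))) -> cvgn (series (fun t => norm2 (w t))) ->
  cvgn (series (fun t => norm2 (v t + w t))).
Proof.
move=> cv cw.
apply: (@series_le_cvg _ _ (2 *: ((fun t => norm2 (v t)) + (fun t => norm2 (w t))))).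
- by move=> t; apply: norm2_ge0.
- by move=> t; rewrite mulr_ge0 // addr_ge0 ?norm2_ge0.
- by move=> t; apply: norm2D.
- by apply/is_cvg_seriesZ/is_cvg_seriesD.
Qed.

Lemma cvg_norm2Z (R : realType) p c (v : nat -> 'cV[R[i]]_p) :
  cvgn (series (fun t => norm2 (v t))) -> cvgn (series (fun t => norm2 (c *: v t))).
Proof.
move=> cv; under [X in series X]eq_fun do rewrite norm2Z.
exact: (@is_cvg_seriesZ _ (fun t => norm2 (v t)) (sqmod c)).
Qed.

Lemma cvg_norm2M (R : realType) p q (M : 'M[R[i]]_(p, q)) v :
  cvgn (series (fun t => norm2 (v t))) -> cvgn (series (fun t => norm2 (M *m v t))).
Proof.
move=> cv; have [c [c0 H]] := mulmx_norm2_bounded M.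
apply: (@series_le_cvg _ _ (c *: (fun t => norm2 (v t)))).
- by move=> t; apply: norm2_ge0.
- by move=> t; rewrite mulr_ge0 ?norm2_ge0.
- by move=> t; apply: H.
- exact: is_cvg_seriesZ.
Qed.

(** * Operations on feasible pairs *)

Lemma feasibleP (R : realType) n m (A : 'M[R[i]]_n) (B : 'M[R[i]]_(n, m)) a x u :
  feasible A B a x u <->
  [/\ forall t, x t.+1 = A *m x t + B *m u t, x 0%N = a,
      cvgn (series (fun t => norm2 (x t))) & cvgn (series (fun t => norm2 (u t)))].
Proof.
have s0 t : 0 <= norm2 (x t) + norm2 (u t) by rewrite addr_ge0 ?norm2_ge0.
split=> [[rec [x0 fin]]|[rec x0 cx cu]].
  have cs := nnseries_is_cvg s0 fin.
  split=> //; apply: series_le_cvg cs => // t; rewrite ?norm2_ge0 //.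
    by rewrite lerDl norm2_ge0.
  by rewrite lerDr norm2_ge0.
split=> //; split=> //.
have cs : cvgn (series (fun t => norm2 (x t) + norm2 (u t))) by exact: is_cvg_seriesD.
have -> : (fun T => \sum_(0 <= t < T) (norm2 (x t) + norm2 (u t))%:E)%E =
  EFin \o series (fun t => norm2 (x t) + norm2 (u t)).
  by apply/funext => T; rewrite /= seriesEnat /= sumEFin.
by rewrite EFin_lim // ltry.
Qed.

Lemma feasibleD (R : realType) n m (A : 'M[R[i]]_n) (B : 'M[R[i]]_(n, m)) a b x u y v :
  feasible A B a x u -> feasible A B b y v ->
  feasible A B (a + b) (fun t => x t + y t) (fun t => u t + v t).
Proof.
move=> /feasibleP[xS x0 cx cu] /feasibleP[yS y0 cy cv]; apply/feasibleP; split.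
- by move=> t; rewrite xS yS !mulmxDr addrACA.
- by rewrite x0 y0.
- exact: cvg_norm2D.
- exact: cvg_norm2D.
Qed.

Lemma feasibleZ (R : realType) n m (A : 'M[R[i]]_n) (B : 'M[R[i]]_(n, m)) c a x u :
  feasible A B a x u -> feasible A B (c *: a) (fun t => c *: x t) (fun t => c *: u t).
Proof.
move=> /feasibleP[xS x0 cx cu]; apply/feasibleP; split.
- by move=> t; rewrite xS scalerDr !scalemxAr.
- by rewrite x0.
- exact: cvg_norm2Z.
- exact: cvg_norm2Z.
Qed.

Lemma feasibleB (R : realType) n m (A : 'M[R[i]]_n) (B : 'M[R[i]]_(n, m)) a b x u y v :
  feasible A B a x u -> feasible A B b y v ->
  feasible A B (a - b) (fun t => x t - y t) (fun t => u t - v t).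
Proof.
move=> fx /(feasibleZ (-1)) /(feasibleD fx).
by under eq_fun do rewrite scaleN1r; under [X in feasible _ _ _ _ X]eq_fun do rewrite scaleN1r;
  rewrite scaleN1r.
Qed.

Definition prepend (T : Type) (a : T) (x : nat -> T) (t : nat) : T :=
  if t is s.+1 then x s else a.

Lemma feasible_prepend (R : realType) n m (A : 'M[R[i]]_n) (B : 'M[R[i]]_(n, m)) a v x u :
  feasible A B (A *m a + B *m v) x u -> feasible A B a (prepend a x) (prepend v u).
Proof.
move=> /feasibleP[xS x0 cx cu]; apply/feasibleP; split=> //.
- by case=> [|t] /=.
- exact: cvgP (cvg_series_shift (f := fun t => norm2 (prepend a x t)) cx).
- exact: cvgP (cvg_series_shift (f := fun t => norm2 (prepend v u t)) cu).
Qed.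

Lemma feasible_tail (R : realType) n m (A : 'M[R[i]]_n) (B : 'M[R[i]]_(n, m)) a x u s :
  feasible A B a x u ->
  feasible A B (x s) (fun t => x (t + s)%N) (fun t => u (t + s)%N).
Proof.
move=> /feasibleP[xS x0 cx cu]; apply/feasibleP; split=> //.
- by move=> t; rewrite addSn xS.
- exact: cvgP (cvg_series_tail (f := fun t => norm2 (x t)) (s := s) cx).
- exact: cvgP (cvg_series_tail (f := fun t => norm2 (u t)) (s := s) cu).
Qed.

Lemma feasible_output (R : realType) n m (A : 'M[R[i]]_n) (B : 'M[R[i]]_(n, m))
    (C : 'M[R[i]]_(m, n)) (D : 'M[R[i]]_m) a x u :
  feasible A B a x u -> cvgn (series (fun t => norm2 (C *m x t + D *m u t))).
Proof. by move=> /feasibleP[_ _ cx cu]; apply: cvg_norm2D; apply: cvg_norm2M. Qed.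
Arguments feasible_output {R n m A B} C D {a x u}.

(** * The optimal output energy *)

(** The [J] of the overview. The set is bounded below by 0, and nonempty once feasible pairs exist,
    so the real infimum is then a genuine one. *)
Definition optval (R : realType) n m (A : 'M[R[i]]_n) (B : 'M[R[i]]_(n, m))
    (C : 'M[R[i]]_(m, n)) (D : 'M[R[i]]_m) (a : 'cV[R[i]]_n) : R :=
  inf [set r | exists x u, feasible A B a x u /\ r = outnorm C D x u].

Lemma outnorm_ge0 (R : realType) n m (A : 'M[R[i]]_n) (B : 'M[R[i]]_(n, m))
    (C : 'M[R[i]]_(m, n)) (D : 'M[R[i]]_m) a x u :
  feasible A B a x u -> 0 <= outnorm C D x u.
Proof.
move=> /(feasible_output C D) co.
by have := series_nneg_le_lim (fun t => norm2_ge0 _) co 0; rewrite [series _ 0]big_geq.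
Qed.

Lemma optval_le (R : realType) n m (A : 'M[R[i]]_n) (B : 'M[R[i]]_(n, m))
    (C : 'M[R[i]]_(m, n)) (D : 'M[R[i]]_m) a x u :
  feasible A B a x u -> optval A B C D a <= outnorm C D x u.
Proof.
move=> fx; apply: ge_inf; last by exists x, u.
by exists 0 => _ [y [v [fy ->]]]; apply: outnorm_ge0 fy.
Qed.

Definition stabilizable (R : realType) n m (A : 'M[R[i]]_n) (B : 'M[R[i]]_(n, m)) :=
  forall a, exists x u, feasible A B a x u.

Lemma optval_ge0 (R : realType) n m (A : 'M[R[i]]_n) (B : 'M[R[i]]_(n, m))
    (C : 'M[R[i]]_(m, n)) (D : 'M[R[i]]_m) a :
  stabilizable A B -> 0 <= optval A B C D a.
Proof.
move=> /(_ a) [x [u fx]]; apply: lb_le_inf; first by exists (outnorm C D x u), x, u.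
by move=> _ [y [v [fy ->]]]; apply: outnorm_ge0 fy.
Qed.

Lemma optval_adherent (R : realType) n m (A : 'M[R[i]]_n) (B : 'M[R[i]]_(n, m))
    (C : 'M[R[i]]_(m, n)) (D : 'M[R[i]]_m) a e :
  stabilizable A B -> 0 < e ->
  exists x u, feasible A B a x u /\ outnorm C D x u < optval A B C D a + e.
Proof.
move=> /(_ a) [x [u fx]] e0.
have [|_ [y [v [fy ->]]] lt] := @inf_adherent _
  [set r | exists x u, feasible A B a x u /\ r = outnorm C D x u] e e0.
  split; first by exists (outnorm C D x u), x, u.
  by exists 0 => _ [y [v [fy ->]]]; apply: outnorm_ge0 fy.
by exists y, v.
Qed.

(** Dynamic programming: a nearly optimal pair from the successor state, preceded by one step with
    input [v], competes from [y]. *)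
Lemma optval_le_step (R : realType) n m (A : 'M[R[i]]_n) (B : 'M[R[i]]_(n, m))
    (C : 'M[R[i]]_(m, n)) (D : 'M[R[i]]_m) y v :
  stabilizable A B ->
  optval A B C D y <= norm2 (C *m y + D *m v) + optval A B C D (A *m y + B *m v).
Proof.
move=> st; apply/ler_addgt0Pr => e e0.
have [x [u [fx lt]]] := optval_adherent C D (A *m y + B *m v) st e0.
apply: le_trans (optval_le C D (feasible_prepend fx)) _.
suff -> : outnorm C D (prepend y x) (prepend v u) =
  norm2 (C *m y + D *m v) + outnorm C D x u by rewrite -addrA lerD2l ltW.
apply/cvg_lim => //.
by apply: (cvg_series_shift
  (f := fun t => norm2 (C *m prepend y x t + D *m prepend v u t))
  (feasible_output C D fx)).
Qed.

Lemma optval_scale_le (R : realType) n m (A : 'M[R[i]]_n) (B : 'M[R[i]]_(n, m))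
    (C : 'M[R[i]]_(m, n)) (D : 'M[R[i]]_m) c a :
  stabilizable A B -> optval A B C D (c *: a) <= sqmod c * optval A B C D a.
Proof.
move=> st; apply/ler_addgt0Pr => e e0.
(* The added 1 keeps the tolerance [e / (sqmod c + 1)] meaningful when [c = 0]. *)
have c1 : 0 < sqmod c + 1 by rewrite ltr_wpDl // sqmod_ge0.
have [x [u [fx lt]]] := optval_adherent C D a st (divr_gt0 e0 c1).
apply: le_trans (optval_le C D (feasibleZ c fx)) _.
have -> : outnorm C D (fun t => c *: x t) (fun t => c *: u t) = sqmod c * outnorm C D x u.
  apply: etrans (lim_seriesZ (sqmod c) (feasible_output C D fx)).
  congr (limn (series _)); apply/funext => t.
  by rewrite -!scalemxAr -scalerDr norm2Z.
apply: le_trans (ler_wpM2l (sqmod_ge0 c) (ltW lt)) _.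
rewrite mulrDr lerD2l mulrA ler_pdivrMr // mulrC ler_pM2l //.
by rewrite lerDl.
Qed.

(** Sums and differences of nearly optimal pairs are feasible, and [outnorm] obeys the parallelogram
    law exactly. Two slacks of [e / 4], doubled, give [e]. *)
Lemma optval_par_le (R : realType) n m (A : 'M[R[i]]_n) (B : 'M[R[i]]_(n, m))
    (C : 'M[R[i]]_(m, n)) (D : 'M[R[i]]_m) a b :
  stabilizable A B ->
  optval A B C D (a + b) + optval A B C D (a - b) <=
  2 * (optval A B C D a + optval A B C D b).
Proof.
move=> st; apply/ler_addgt0Pr => e e0.
have e4 : 0 < e / 4 by apply: divr_gt0.
have [x [u [fx lx]]] := optval_adherent C D a st e4.
have [y [v [fy ly]]] := optval_adherent C D b st e4.
have fp := feasibleD fx fy; have fm := feasibleB fx fy.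
suff H : outnorm C D (fun t => x t + y t) (fun t => u t + v t) +
  outnorm C D (fun t => x t - y t) (fun t => u t - v t) =
  2 * (outnorm C D x u + outnorm C D y v).
  move: (optval_le C D fp) (optval_le C D fm) lx ly H.
  move: (outnorm C D (fun t => x t + y t) _) (outnorm C D (fun t => x t - y t) _).
  move: (outnorm C D x u) (outnorm C D y v) (optval _ _ _ _ (a + b)).
  move: (optval _ _ _ _ (a - b)) (optval _ _ _ _ a) (optval _ _ _ _ b) => *; lra.
apply: etrans (esym (lim_seriesD (feasible_output C D fp) (feasible_output C D fm))) _.
apply: etrans (etrans (lim_seriesZ 2 (is_cvg_seriesD (feasible_output C D fx)
  (feasible_output C D fy))) (congr1 ( *%R 2) (lim_seriesD
  (feasible_output C D fx) (feasible_output C D fy)))).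
congr (limn (series _)); apply/funext => t.
rewrite !fctE; apply: etrans (norm2_par _ _).
by rewrite !mulmxDr !mulmxN opprD; congr (_ + _); congr norm2; rewrite addrACA.
Qed.

Lemma optval_quadratic (R : realType) n m (A : 'M[R[i]]_n) (B : 'M[R[i]]_(n, m))
    (C : 'M[R[i]]_(m, n)) (D : 'M[R[i]]_m) :
  stabilizable A B -> quadratic (optval A B C D).
Proof.
move=> st.
have JZ c a : optval A B C D (c *: a) = sqmod c * optval A B C D a.
  apply/eqP; rewrite eq_le optval_scale_le //=.
  have [->|c0] := eqVneq c 0.
    by rewrite -[0]/(0%:C) sqmod_real expr0n mul0r optval_ge0.
  have := optval_scale_le C D c^-1 (c *: a) st.
  rewrite scalerA mulVf // scale1r => /(ler_wpM2l (sqmod_ge0 c)).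
  have s1 : sqmod (1 : R[i]) = 1 by rewrite /sqmod /=; ring.
  by rewrite mulrA -sqmodM divff // s1 mul1r.
split=> //; first by move=> v; apply: optval_ge0.
move=> v w; apply/eqP; rewrite eq_le optval_par_le //=.
(* The reverse inequality is the same bound for [v + w] and [v - w], whose sum and difference are
   [2 v] and [2 w]; scaling contributes a factor 4. *)
have := optval_par_le C D (v + w) (v - w) st.
have s2 : sqmod (2%:R : R[i]) = 4%:R by rewrite /sqmod /=; ring.
have -> : v + w + (v - w) = 2%:R *: v.
  by rewrite addrACA subrr addr0 scaler_nat mulr2n.
have -> : v + w - (v - w) = 2%:R *: w.
  by rewrite opprB addrC addrA subrK scaler_nat mulr2n.
rewrite !JZ s2; move: (optval _ _ _ _ (v + w)) (optval _ _ _ _ (v - w)).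
by move: (optval _ _ _ _ v) (optval _ _ _ _ w) => *; lra.
Qed.

(** * Stabilizing feedback yields feasible pairs *)

Lemma cvg_norm2_contraction (R : realType) n (l : R[i]) (z w : nat -> 'cV[R[i]]_n) :
  sqmod l < 1 -> (forall t, z t.+1 = l *: z t + w t) ->
  cvgn (series (fun t => norm2 (w t))) -> cvgn (series (fun t => norm2 (z t))).
Proof.
move=> l1 zS cw; have l0 := sqmod_ge0 l.
(* Small enough that the Young weight leaves [r = (1 + e) * sqmod l] below 1. *)
pose e := (1 - sqmod l) / 2; have e0 : 0 < e by rewrite divr_gt0 // subr_gt0.
pose r := (1 + e) * sqmod l.
have r1 : r < 1 by rewrite /r /e; nra.
have r0 : 0 <= r by rewrite mulr_ge0 // addr_ge0 ?ler01 // ltW.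
pose c := 1 + e^-1; have c0 : 0 <= c by rewrite addr_ge0 // invr_ge0 ltW.
pose W := limn (series (fun t => norm2 (w t))).
(* The bound is the fixed point of [M = norm2 (z 0) + r * M + c * W], the recursion obeyed by the
   partial sums. *)
apply: (@bounded_cvg_series _ _ ((norm2 (z 0%N) + c * W) / (1 - r))).
  by move=> t; apply: norm2_ge0.
elim=> [|T IH].
  rewrite [series _ 0]big_geq // divr_ge0 ?subr_ge0 ?(ltW r1) //.
  rewrite addr_ge0 ?norm2_ge0 ?mulr_ge0 //.
  have := series_nneg_le_lim (fun t => norm2_ge0 (w t)) cw 0.
  by rewrite [series _ 0]big_geq.
rewrite series_shiftE.
have wT := series_nneg_le_lim (fun t => norm2_ge0 (w t)) cw T.
have zT : series (fun t => norm2 (z t.+1)) T <=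
    r * series (fun t => norm2 (z t)) T + c * series (fun t => norm2 (w t)) T.
  rewrite !seriesEnat /= !mulr_sumr -big_split; apply: ler_sum => t _ /=.
  rewrite zS; apply: le_trans (norm2_young _ _ e0) _.
  by rewrite norm2Z mulrA.
apply: (@le_trans _ _ (norm2 (z 0%N) + (r * ((norm2 (z 0%N) + c * W) / (1 - r)) + c * W))).
  rewrite lerD2l; apply: le_trans zT _.
  by apply: lerD; apply: ler_wpM2l.
rewrite le_eqVlt; apply/orP; left; apply/eqP; field.
by rewrite subr_eq0 gt_eqF.
Qed.

(** Root induction: if the orbit of [G *m x - l *: x] is square summable, it drives the scalar
    recursion with factor [l] satisfied by the orbit of [x]. *)
Lemma cvg_norm2_iter (R : realType) n (G : 'M[R[i]]_n) :
  (forall l, eigenvalue G l -> sqmod l < 1) ->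
  forall x, cvgn (series (fun t => norm2 (iter t (mulmx G) x))).
Proof.
move=> Gl.
apply: (@char_poly_root_ind _ _ G
  (fun x => cvgn (series (fun t => norm2 (iter t (mulmx G) x))))).
  have iter0 t : iter t (mulmx G) 0 = 0 :> 'cV_n.
    by elim: t => // t IH; rewrite iterS IH mulmx0.
  under [X in series X]eq_fun do rewrite iter0 norm20.
  apply: (@bounded_cvg_series _ _ 0) => // T.
  by rewrite seriesEnat /= big1.
move=> l x /Gl l1; apply: cvg_norm2_contraction l1 _ => t.
apply/eqP; rewrite addrC -subr_eq eq_sym; apply/eqP.
by elim: t => // t IH; rewrite 2!iterS IH mulmxBr scalemxAr.
Qed.

Lemma sqmod_ltP (R : rcfType) (l : R[i]) : (sqmod l < 1) = ~~ (1 <= `|l|).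
Proof.
rewrite ltNge; congr negb; rewrite -(@expr_ge1 _ 2) // -sqmodE.
by rewrite -[1 in RHS]/(1%:C) lecR.
Qed.

Lemma stabilizable_feedback (R : realType) n m (A : 'M[R[i]]_n) (B : 'M[R[i]]_(n, m))
    (K : 'M[R[i]]_(m, n)) :
  (forall z : R[i], 1 <= `|z| -> z%:M - A - B *m K \in unitmx) -> stabilizable A B.
Proof.
move=> HK a; pose G := A + B *m K.
have Gl l : eigenvalue G l -> sqmod l < 1.
  move=> /eigenvalueP[v vG v0]; rewrite sqmod_ltP; apply/negP => /HK U.
  move/eqP: v0; apply; rewrite -[v](mulmxK U).
  by rewrite -addrA -opprD mulmxBr vG mul_mx_scalar subrr mul0mx.
have cG := @cvg_norm2_iter R n G Gl a.
exists (fun t => iter t (mulmx G) a), (fun t => K *m iter t (mulmx G) a).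
apply/feasibleP; split=> //; last exact: cvg_norm2M.
by move=> t /=; rewrite mulmxDl mulmxA.
Qed.

(** * Zero dynamics and the determinant condition *)

(** The closed loop under the input [- D^-1 C x], which makes the output [C x + D u] vanish. *)
Definition zero_dynamics (R : realType) n m (A : 'M[R[i]]_n) (B : 'M[R[i]]_(n, m))
    (C : 'M[R[i]]_(m, n)) (D : 'M[R[i]]_m) : 'M[R[i]]_n :=
  A - B *m invmx D *m C.

(** At [lam = 0] the pencil is block lower triangular with diagonal blocks [- 1] and [D]. *)
Lemma pencil_unitmx (R : realType) n m (A : 'M[R[i]]_n) (B : 'M[R[i]]_(n, m))
    (C : 'M[R[i]]_(m, n)) (D : 'M[R[i]]_m) :
  (forall lam : R[i], `|lam| < 1 ->
      \det (block_mx (lam *: A - 1%:M) (lam *: B) C D) != 0) ->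
  D \in unitmx.
Proof.
move=> /(_ 0); rewrite normr0 ltr01 => /(_ isT).
by rewrite !scale0r det_lblock mulf_eq0 negb_or unitmxE unitfE => /andP[].
Qed.

(** A left eigenvector [v] with [|l| > 1] would extend to the row [(v, - l^-1 v B D^-1)], which
    annihilates the pencil at [lam = l^-1], inside the open disc. *)
Lemma pencil_eigenvalue (R : realType) n m (A : 'M[R[i]]_n) (B : 'M[R[i]]_(n, m))
    (C : 'M[R[i]]_(m, n)) (D : 'M[R[i]]_m) (l : R[i]) :
  (forall lam : R[i], `|lam| < 1 ->
      \det (block_mx (lam *: A - 1%:M) (lam *: B) C D) != 0) ->
  eigenvalue (zero_dynamics A B C D) l -> sqmod l <= 1.
Proof.
move=> Hdet /eigenvalueP[v vF v0]; rewrite leNgt; apply/negP => l1.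
have UD := pencil_unitmx Hdet.
have l0 : l != 0.
  by apply/eqP => l0; move: l1; rewrite l0 /sqmod /= expr0n addr0 ltr10.
have ll : `|l^-1| < 1.
  rewrite normfV invf_lt1 ?normr_gt0 // -(@expr_gt1 _ 2) // -sqmodE.
  by rewrite -[1]/(1%:C) ltcR.
have := Hdet _ ll; set M := block_mx _ _ _ _ => dM.
have UM : M \in unitmx by rewrite unitmxE unitfE.
pose q := - (l^-1 *: (v *m B *m invmx D)).
have qM : row_mx v q *m M = 0.
  rewrite mul_row_block -[RHS]row_mx0; congr row_mx; last first.
    by rewrite mulNmx -scalemxAl mulmxKV // -scalemxAr subrr.
  rewrite mulNmx -scalemxAl mulmxBr mulmx1 -scalemxAr addrAC -scalerBr.
  rewrite -!mulmxA -mulmxBr mulmxA -[A - _]/(zero_dynamics A B C D) vF.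
  by rewrite scalerA mulVf // scale1r subrr.
move/eqP: v0; apply.
have := mulmxK UM (row_mx v q); rewrite qM mul0mx => /esym.
by rewrite -row_mx0 => /eq_row_mx[].
Qed.

(** * The optimal output energy vanishes *)

Lemma optval_tail_le (R : realType) n m (A : 'M[R[i]]_n) (B : 'M[R[i]]_(n, m))
    (C : 'M[R[i]]_(m, n)) (D : 'M[R[i]]_m) a x u t :
  feasible A B a x u ->
  optval A B C D (x t) <=
  outnorm C D x u - series (fun t => norm2 (C *m x t + D *m u t)) t.
Proof.
move=> fx; apply: le_trans (optval_le C D (feasible_tail t fx)) _.
rewrite le_eqVlt; apply/orP; left; apply/eqP; apply: cvg_lim => //.
exact: (cvg_series_tail (f := fun t => norm2 (C *m x t + D *m u t)) (s := t)
  (feasible_output C D fx)).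
Qed.

Lemma optval_eq0 (R : realType) n m (A : 'M[R[i]]_n) (B : 'M[R[i]]_(n, m))
    (C : 'M[R[i]]_(m, n)) (D : 'M[R[i]]_m) :
  stabilizable A B -> D \in unitmx ->
  (forall l, eigenvalue (zero_dynamics A B C D) l -> sqmod l <= 1) ->
  forall x, optval A B C D x = 0.
Proof.
move=> st UD Fl; set F := zero_dynamics A B C D in Fl *.
have qJ := optval_quadratic C D st; have [J0 JZ _] := qJ.
(* The extra input -D^-1 C z contributes nothing to the output. *)
have step y v z : optval A B C D (y + z) <=
    norm2 (C *m y + D *m v) + optval A B C D (A *m y + B *m v + F *m z).
  have := optval_le_step C D (y + z) (v - invmx D *m (C *m z)) st.
  have -> : C *m (y + z) + D *m (v - invmx D *m (C *m z)) = C *m y + D *m v.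
    by rewrite (mulmxDr C) (mulmxBr D) mulKVmx // addrACA subrr addr0.
  have -> // : A *m (y + z) + B *m (v - invmx D *m (C *m z)) =
    A *m y + B *m v + F *m z.
  by rewrite (mulmxDr A) (mulmxBr B) mulmxBl !mulmxA addrACA.
apply: (@char_poly_root_ind _ _ F (fun x => optval A B C D x = 0)).
  by have := JZ 0 0; rewrite scale0r /sqmod /= expr0n addr0 mul0r.
move=> l x /Fl; rewrite le_eqVlt => /orP[/eqP l1|l1] Fx.
  have [y [u fy]] := st x.
  have [yS [y0 _]] := fy.
  have le t : optval A B C D x <= optval A B C D (y t).
    apply: (quadratic_le_unimodular (e := fun t => norm2 (C *m y t + D *m u t))
      qJ l1 Fx _ y0) => s z.
    by rewrite yS; apply: step.
  (* Every partial sum of the output energy stays below the total minus [J x]; in the limit this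
     leaves [J x <= 0]. *)
  have : outnorm C D y u <= outnorm C D y u - optval A B C D x.
    apply: limr_le; first exact: feasible_output fy.
    apply: nearW => t; have := le_trans (le t) (optval_tail_le C D t fy).
    by rewrite lerBrDr -lerBrDl.
  by rewrite lerDl oppr_ge0 => H; apply/eqP; rewrite eq_le H J0.
(* Case [|l| < 1]: from the zero state and input the step reads [J x <= J (F x)], and [F x] differs
   from [l x] by a null vector. *)
have := step 0 0 x; rewrite !mulmx0 !add0r norm20 add0r -[F *m x](subrK (l *: x)).
rewrite addrC quadratic_null // JZ => H; apply/eqP; rewrite eq_le J0 andbT.
by rewrite -(@pmulr_rle0 _ (1 - sqmod l)) ?subr_gt0 // mulrBl mul1r subr_le0.
Qed.

(** * Storage balance and conclusion *)

(** The storage terms telescope to [p T - p 0], and [p T] tends to 0 because it is dominated by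
    [norm2 (x T)], the general term of a convergent series. *)
Lemma storage_balance (R : realType) n m
  (A : 'M[R[i]]_n) (B : 'M[R[i]]_(n, m)) (Q : 'M[R[i]]_(n + m))
  (P : 'M[R[i]]_n) (C : 'M[R[i]]_(m, n)) (D : 'M[R[i]]_m) (a : 'cV[R[i]]_n) x u :
  (forall (x : 'cV[R[i]]_n) (u : 'cV[R[i]]_m),
      sigmaQ Q x u + (ctmx x *m P *m x) 0 0
        - (ctmx (A *m x + B *m u) *m P *m (A *m x + B *m u)) 0 0
      = (norm2 (C *m x + D *m u))%:C) ->
  feasible A B a x u ->
  Phi Q x u = outnorm C D x u - complex.Re ((ctmx a *m P *m a) 0 0).
Proof.
move=> HP fx; have /feasibleP[xS x0 cx cu] := fx.
pose p t : R := complex.Re ((ctmx (x t) *m P *m x t) 0 0).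
have pS t : complex.Re (sigmaQ Q (x t) (u t)) =
    norm2 (C *m x t + D *m u t) + (p t.+1 - p t).
  have := congr1 (@complex.Re R) (HP (x t) (u t)).
  rewrite -xS !raddfD raddfN /= -/(p t) -/(p t.+1) => <-; ring.
have E : series (fun t => complex.Re (sigmaQ Q (x t) (u t))) =
    (fun T => series (fun t => norm2 (C *m x t + D *m u t)) T + (p T - p 0%N)).
  apply/funext => T; rewrite !seriesEnat /=.
  by under eq_bigr do rewrite pS; rewrite big_split /= telescope_sumr.
have [c cP] := form_norm2_bounded P.
have p0 : p @ \oo --> (0 : R).
  apply/norm_cvg0P.
  have cx0 : (fun t => c * norm2 (x t)) @ \oo --> (0 : R).
    rewrite -[X in _ --> X](mulr0 c); apply: cvgM; first exact: cvg_cst.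
    exact: cvg_series_cvg_0 cx.
  apply: (squeeze_cvgr _ (cvg_cst (0 : R)) cx0).
  by apply: nearW => t; rewrite normr_ge0 cP.
rewrite /Phi E -x0; apply: cvg_lim => //.
rewrite -[X in _ - X]/(p 0%N) -[X in _ --> _ + X]add0r.
apply: cvgD; first exact: feasible_output fx.
exact: (cvgB p0 (cvg_cst _)).
Qed.

Theorem theorem1p2 (R : realType) (n m : nat)
  (A : 'M[R[i]]_n) (B : 'M[R[i]]_(n, m)) (Q : 'M[R[i]]_(n + m))
  (P : 'M[R[i]]_n) (C : 'M[R[i]]_(m, n)) (D : 'M[R[i]]_m) (a : 'cV[R[i]]_n) :
  (exists K : 'M[R[i]]_(m, n), forall z : R[i], 1 <= `|z| ->
      z%:M - A - B *m K \in unitmx) ->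
  hermmx Q ->
  (exists S : seq R[i], forall z : R[i], `|z| = 1 -> z \notin S ->
      z%:M - A \in unitmx /\ posdef (PiQ A B Q z)) ->
  hermmx P ->
  (forall (x : 'cV[R[i]]_n) (u : 'cV[R[i]]_m),
      sigmaQ Q x u + (ctmx x *m P *m x) 0 0
        - (ctmx (A *m x + B *m u) *m P *m (A *m x + B *m u)) 0 0
      = (norm2 (C *m x + D *m u))%:C) ->
  (forall lam : R[i], `|lam| < 1 ->
      \det (block_mx (lam *: A - 1%:M) (lam *: B) C D) != 0) ->
  ereal_inf [set r : \bar R | exists x u, feasible A B a x u /\ r = (Phi Q x u)%:E]
    = (- complex.Re ((ctmx a *m P *m a) 0 0))%:E
  /\
  (forall (xs : nat -> nat -> 'cV[R[i]]_n) (us : nat -> nat -> 'cV[R[i]]_m),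
      (forall k, feasible A B a (xs k) (us k)) ->
      ((fun k => outnorm C D (xs k) (us k)) @ \oo --> (0 : R)) <->
      ((fun k => Phi Q (xs k) (us k)) @ \oo --> - complex.Re ((ctmx a *m P *m a) 0 0))).
Proof.
move=> [K HK] _ _ _ HP Hdet.
have st := stabilizable_feedback HK.
have J0 := optval_eq0 st (pencil_unitmx Hdet) (fun l => pencil_eigenvalue (l := l) Hdet) a.
have PhiE x u (fx : feasible A B a x u) := storage_balance HP fx.
set p := complex.Re _; split.
  apply/eqP; rewrite eq_le; apply/andP; split.
    (* As [optval] is 0, some feasible pair has output energy below [e], hence cost below
       [- p + e]. *)
    apply/lee_addgt0Pr => e e0.
    have [x [u [fx lt]]] := optval_adherent C D a st e0.
    apply: (le_trans (ereal_inf_lbound _)); first by exists x, u.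
    by rewrite (PhiE _ _ fx) -EFinD lee_fin addrC lerD2l ltW // -(add0r e) -J0.
  apply: le_ereal_inf_tmp => _ [x [u [fx ->]]].
  by rewrite (PhiE _ _ fx) lee_fin lerDr (outnorm_ge0 C D fx).
move=> xs us fxs.
have E : (fun k => Phi Q (xs k) (us k)) = (fun k => outnorm C D (xs k) (us k) - p).
  by apply/funext => k; rewrite (PhiE _ _ (fxs k)).
have E' : (fun k => outnorm C D (xs k) (us k)) = (fun k => Phi Q (xs k) (us k) + p).
  by apply/funext => k; rewrite (PhiE _ _ (fxs k)) subrK.
split=> H.
  by rewrite E -[X in _ --> X]add0r; apply: (cvgB H (cvg_cst _)).
by rewrite E' -[X in _ --> X](addNr p); apply: (cvgD H (cvg_cst _)).
Qed.
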